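(* Let $k, \ell, n$ be fixed nonnegative integers, and for each nonnegative integer $m$ let $U_m = (T_{1,\ell}^v:S_{2,n}^w)_k^{(m)}$. Then: (i) $\alpha(U_m) = k(n+1)m + \ell + 1$; (ii) $RI(U_m;x) = RI(S_{2,\ell};x)\,\bigl(RI(T_{k,n};x)\bigr)^m + \bigl(RI(P_2;x)\bigr)^\ell\,\bigl(RI(S_{2,n};x)\bigr)^{km}$; (iii) the sequence $(RI(U_m;x))_{m\geq 0}$ is linearly recurrent with characteristic polynomial $\chi_1(r) = \bigl(r - (RI(S_{2,n};x))^k\bigr)\bigl(r - RI(T_{k,n};x)\bigr)$.
   Context: $I(G;x)=\sum_i s_ix^i$ with $s_i$ the number of independent sets of size $i$; $\alpha(G)=\deg I(G;x)$ is the independence number. For $p\in\mathbb{R}[x]$ of degree $d$, $(Rp)(x)=x^dp(1/x)$. For a rooted graph $H^w$ and $k\ge0$, $Z_k(H^w)$ is a new vertex $v_0$ joined to the roots of $k$ disjoint copies of $H$; $(G^v:H^w)_k$ is the disjoint union of $G$ and $Z_k(H^w)$ plus the edge $vv_0$, rooted at $v$; recursively $(G^v:H^w)_{i_1,\ldots,i_j}=((G^v:H^w)_{i_1,\ldots,i_{j-1}}^v:H^w)_{i_j}$ (empty sequence giving $G^v$), and $(G^v:H^w)_k^{(m)}$ uses $k$ repeated $m$ times. $P_t^w$ is the path on $t$ vertices rooted at a leaf. $S_{2,t}^w=(P_1^w:P_1^w)_1^{(t)}$ (the spider with $t$ legs of length 2, rooted at its center). $T_{m,t}^v=(P_1^v:P_2^w)_t^{(m)}$.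 A sequence $(q_m)$ is linearly recurrent with characteristic polynomial $r^2-c_1r-c_0$ if $q_m=c_1q_{m-1}+c_0q_{m-2}$ for $m\ge2$.
   Formalization: The formal theorem assumes k ≥ 1; for k = 0 the statement is false, since U_m is then T_{1,ℓ} with m pendant vertices at v, so α(U_m) = ℓ+1+m for m ≥ 1, and (ii) for m ≥ 1 and (iii) fail as well. *)

(* Defs.v *)
From HB Require Import structures.
From mathcomp Require Import all_boot all_order all_algebra.
From mathcomp Require Import reals.

Set Implicit Arguments.
Unset Strict Implicit.
Unset Printing Implicit Defensive.

Import Order.TTheory GRing.Theory Num.Theory.
Local Open Scope ring_scope.

Record sgraph := SGraph {
  vertex :> finType;
  adj : rel vertex;
  adj_sym : symmetric adj;
  adj_irr : irreflexive adj
}.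

Record rgraph := RGraph {
  graph_of :> sgraph;
  root_of : graph_of
}.

Section Independence.
Variable G : sgraph.

Definition independent (A : {set G}) : bool :=
  [forall x in A, forall y in A, ~~ adj x y].

Definition num_indep (i : nat) : nat :=
  #|[set A : {set G} | independent A && (#|A| == i)]|.

Definition alpha : nat := \max_(A : {set G} | independent A) #|A|.

Definition indep_poly (R : realType) : {poly R} :=
  \poly_(i < #|G|.+1) (num_indep i)%:R.

Lemma independent0 : independent set0.
Proof. by apply/forall_inP => x; rewrite inE. Qed.

Lemma size_indep_poly (R : realType) : size (indep_poly R) = alpha.+1.
Proof.
have [A iA EA] : exists2 A, independent A & alpha = #|A|.
  have := @eq_bigmax_cond _ independent (fun A : {set G} => #|A|).
  case; first by apply/card_gt0P; exists set0; exact: independent0.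
  by move=> A iA EA; exists A.
have nz : (indep_poly R)`_alpha != 0.
  rewrite coef_poly EA ltnS max_card pnatr_eq0 -lt0n.
  by apply/card_gt0P; exists A; rewrite inE iA eqxx.
apply/eqP; rewrite eqn_leq; apply/andP; split; last first.
  by rewrite ltnNge; apply: contra nz => /leq_sizeP/(_ _ (leqnn _)) ->.
apply/leq_sizeP => j lej; rewrite coef_poly; case: ifP => // _.
rewrite (_ : num_indep j = 0%N) //; apply/eqP; rewrite cards_eq0.
apply/eqP/setP => B; rewrite !inE; apply/negbTE/negP => /andP[iB /eqP EB].
by move: lej; rewrite -EB ltnNge => /negP; apply; exact: leq_bigmax_cond.
Qed.

End Independence.

(* x^d p(1/x) with d = deg p, expanded monomial by monomial *)
Definition recip (R : nzRingType) (p : {poly R}) : {poly R} :=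
  \sum_(i < size p) p`_i *: 'X^((size p).-1 - i).

Lemma horner_recip (R : fieldType) (p : {poly R}) (x : R) :
  x != 0 -> (recip p).[x] = x ^+ (size p).-1 * p.[x^-1].
Proof.
move=> x0; rewrite /recip horner_sum horner_coef mulr_sumr.
apply: eq_bigr => i _; rewrite hornerZ hornerXn exprB ?unitfE //.
  by rewrite -exprVn mulrCA.
by rewrite -ltnS (ltn_predK (ltn_ord i)).
Qed.

Definition RI (R : realType) (G : sgraph) : {poly R} := recip (indep_poly G R).

Section ZGraph.
Variables (H : rgraph) (k : nat).

(* None is v_0 and Some (i, u) is the vertex u of the i-th copy of H *)
Definition Zadj (a b : option ('I_k * H)) : bool :=
  match a, b with
  | None, None => false
  | None, Some (_, u) => u == root_of H
  | Some (_, u), None => u == root_of H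
  | Some (i, u), Some (j, w) => (i == j) && adj u w
  end.

Fact Zadj_sym : symmetric Zadj.
Proof. by move=> [[i u]|] [[j w]|] //=; rewrite eq_sym adj_sym. Qed.

Fact Zadj_irr : irreflexive Zadj.
Proof. by move=> [[i u]|] //=; rewrite adj_irr andbF. Qed.

Definition Zgraph : rgraph :=
  @RGraph (SGraph Zadj_sym Zadj_irr) (None : option ('I_k * H)).

End ZGraph.

Section Link.
Variables (G K : rgraph).

Definition link_adj (a b : G + K) : bool :=
  match a, b with
  | inl x, inl y => adj x y
  | inr x, inr y => adj x y
  | inl x, inr y => (x == root_of G) && (y == root_of K)
  | inr y, inl x => (x == root_of G) && (y == root_of K)
  end.

Fact link_sym : symmetric link_adj.
Proof. by move=> [x|x] [y|y] //=; rewrite adj_sym. Qed.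

Fact link_irr : irreflexive link_adj.
Proof. by move=> [x|x] //=; rewrite adj_irr. Qed.

Definition link : rgraph :=
  @RGraph (SGraph link_sym link_irr) (inl (root_of G) : G + K).

End Link.

(* (G^v : H^w)_k *)
Definition attach (G H : rgraph) (k : nat) : rgraph := link G (Zgraph H k).

(* (G^v : H^w)_{i_1, ..., i_j} *)
Definition attach_seq (G H : rgraph) (s : seq nat) : rgraph :=
  foldl (fun G' i => attach G' H i) G s.

(* (G^v : H^w)_k^{(m)} *)
Definition attach_rep (G H : rgraph) (k m : nat) : rgraph :=
  attach_seq G H (nseq m k).

Section Path.
Variable t : nat.

(* The path on t vertices for t >= 1; since a rooted graph is nonempty,
   Pgraph 0 is by convention the one-vertex path. *)
Definition path_adj (i j : 'I_t.-1.+1) : bool := (i.+1 == j) || (j.+1 == i).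

Fact path_sym : symmetric path_adj.
Proof. by move=> i j; rewrite /path_adj orbC. Qed.

Fact path_irr : irreflexive path_adj.
Proof. by move=> i; rewrite /path_adj orbb gtn_eqF. Qed.

Definition Pgraph : rgraph :=
  @RGraph (SGraph path_sym path_irr) (ord0 : 'I_t.-1.+1).

End Path.

Definition S2graph (t : nat) : rgraph := attach_rep (Pgraph 1) (Pgraph 1) 1 t.

Definition Tgraph (m t : nat) : rgraph := attach_rep (Pgraph 1) (Pgraph 2) t m.

Definition Ugraph (k l n m : nat) : rgraph := attach_rep (Tgraph 1 l) (S2graph n) k m.

Definition linearly_recurrent2 (A : comNzRingType) (q : nat -> A)
    (chi : {poly A}) : Prop :=
  exists c1 c0 : A, chi = 'X^2 - c1 *: 'X - c0%:P /\
    forall m : nat, (2 <= m)%N -> q m = c1 * q (m - 1)%N + c0 * q (m - 2)%N.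

(* Main.v *)
(** Split [I(G)] of a rooted graph as [a + b], where [a] and [b] count the
    independent sets avoiding and containing the root.  Attaching [Z_k(H)]
    multiplies [a] by [I(Z_k(H)) = I(H)^k + x a(H)^k] and [b] by [I(H)^k], so
    both parts are geometric in the number of attachments; for [H = S_{2,n}]
    the first factor is [I(T_{k,n})].  Hence
      [I(U_m) = I(S_{2,l}) I(T_{k,n})^m + x I(P_2)^l I(S_{2,n})^(km)].
    For [k > 0] both summands have degree [k(n+1)m + l + 1], so reversal acts
    termwise, and the recurrence holds for any sum of two geometric
    sequences. *)
Require Import Defs.
From HB Require Import structures.
From mathcomp Require Import all_boot all_order all_algebra.
From mathcomp Require Import reals ring.

Set Implicit Arguments.
Unset Strict Implicit.
Unset Printing Implicit Defensive.

Import Order.TTheory GRing.Theory Num.Theory.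
Local Open Scope ring_scope.

(** * Subsets of disjoint unions and their sizes *)

Lemma independentP (G : sgraph) (A : {set G}) :
  reflect {in A &, forall x y, ~~ adj x y} (independent A).
Proof.
apply: (iffP forall_inP) => [h x y Ax Ay|h x Ax].
  by have /forall_inP/(_ y Ay) := h x Ax.
by apply/forall_inP => y; apply: h.
Qed.

Lemma card_set_option (T : finType) (A : {set option T}) :
  #|A| = ((None \in A) + #|[set x | Some x \in A]|)%N.
Proof.
rewrite (cardsD1 None); congr (_ + _)%N.
rewrite -[RHS](card_imset _ Some_inj); apply: eq_card => -[x|]; rewrite !inE /=.
  by rewrite (mem_imset _ _ Some_inj) inE.
by apply/esym/negbTE/imsetP => -[].
Qed.

Lemma card_set_sum (T U : finType) (A : {set T + U}) :
  #|A| = (#|[set x | inl x \in A]| + #|[set y | inr y \in A]|)%N.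
Proof.
by rewrite -sum1_card big_mkcond big_sumType /= -!big_mkcond /= !sum1dep_card.
Qed.

Definition sum_set (T U : finType) (P : {set T} * {set U}) : {set T + U} :=
  [set z | match z with inl x => x \in P.1 | inr y => y \in P.2 end].

Lemma sum_set_bij (T U : finType) : bijective (@sum_set T U).
Proof.
exists (fun A : {set T + U} => ([set x | inl x \in A], [set y | inr y \in A])).
  by move=> [A B]; congr (_, _); apply/setP => x; rewrite !inE.
by move=> A; apply/setP => -[x|y]; rewrite !inE.
Qed.

Lemma card_sum_set (T U : finType) P : #|@sum_set T U P| = (#|P.1| + #|P.2|)%N.
Proof.
by rewrite card_set_sum; congr (_ + _)%N; apply: eq_card => x; rewrite !inE.
Qed.

(** A vertex set of [Zgraph]: a flag for $v_0$ and the trace on each copy. Traces form a finite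
    function so that a sum over them factors as a product. *)
Definition bundle (T : finType) k (P : bool * {ffun 'I_k -> {set T}}) :
    {set option ('I_k * T)} :=
  [set z | if z is Some iu then iu.2 \in P.2 iu.1 else P.1].

Lemma bundle_bij (T : finType) k : bijective (@bundle T k).
Proof.
exists (fun A : {set option ('I_k * T)} => (None \in A, [ffun i => [set u | Some (i, u) \in A]])).
  move=> [b f]; rewrite inE; congr (_, _); apply/ffunP => i; rewrite ffunE.
  by apply/setP => u; rewrite !inE.
by move=> A; apply/setP => -[[i u]|]; rewrite !inE //= ffunE inE.
Qed.

Lemma card_bundle (T : finType) k (P : bool * {ffun 'I_k -> {set T}}) :
  #|bundle P| = (P.1 + \sum_i #|P.2 i|)%N.
Proof.
rewrite card_set_option inE; congr (_ + _)%N.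
under eq_bigr do rewrite -sum1_card.
by rewrite pair_big_dep /= sum1_card; apply: eq_card => -[i u]; rewrite !inE.
Qed.

(** * Independence polynomials split at the root *)

Section RootedPoly.
Variable R : realType.
(* Qualified because [fingraph] exports another [rgraph]. *)
Implicit Types G H K : Defs.rgraph.

(** A sum over sets, unlike a list of coefficients, can be reindexed along bijections of vertex
    sets. *)
Lemma indep_polyE (G : sgraph) :
  indep_poly G R = \sum_(A : {set G} | independent A) 'X^#|A|.
Proof.
apply/polyP => i; rewrite coef_poly coef_sum /num_indep.
under eq_bigr do rewrite coefXn.
rewrite -natr_sum -big_mkcondr sum1dep_card /=.
under [in RHS]eq_finset do rewrite eq_sym.
(* Beyond the truncation degree no vertex set is large enough. *)
case: ltnP => // lti; rewrite [in RHS](_ : finset _ = set0) ?cards0 //.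
apply/setP => A; rewrite !inE; apply/negbTE/negP => /andP[_ /eqP Ai].
by move: lti; rewrite -Ai ltnNge max_card.
Qed.

(** With $v$ the root, these are $I(G-v)$ and $x\,I(G-N[v])$. *)
Definition rooted_poly G (b : bool) : {poly R} :=
  \sum_(A : {set G} | independent A && ((root_of G \in A) == b)) 'X^#|A|.

Lemma indep_poly_rooted G :
  indep_poly G R = rooted_poly G false + rooted_poly G true.
Proof.
rewrite indep_polyE (bigID (fun A : {set G} => root_of G \in A)) addrC /=.
by congr (_ + _); apply: eq_bigl => A; rewrite ?eqb_id ?eqbF_neg.
Qed.

Lemma independent_sum_set G K (P : {set G} * {set K}) :
  independent (sum_set P : {set link G K}) =
  [&& independent P.1, independent P.2 &
      ~~ ((root_of G \in P.1) && (root_of K \in P.2))].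
Proof.
apply/independentP/and3P => [h|[/independentP h1 /independentP h2 h3]].
  split.
  - by apply/independentP => x y Px Py; apply: (h (inl x) (inl y)); rewrite inE.
  - by apply/independentP => x y Px Py; apply: (h (inr x) (inr y)); rewrite inE.
  - apply/negP => /andP[Px Py].
    by have := h (inl (root_of G)) (inr (root_of K)); rewrite !inE /= !eqxx => /(_ Px Py).
have cross x y : x \in P.1 -> y \in P.2 -> ~~ ((x == root_of G) && (y == root_of K)).
  by move=> Px Py; apply: contra h3 => /andP[/eqP<- /eqP<-]; rewrite Px Py.
move=> [x|x] [y|y]; rewrite !inE /= => Px Py; [exact: h1|exact: cross| |exact: h2].
exact: cross.
Qed.

(** Without the root of [G], the linking edge imposes no constraint, so the two sides are chosen
    independently. *)
Lemma rooted_poly_link_false G K :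
  rooted_poly (link G K) false = rooted_poly G false * indep_poly K R.
Proof.
rewrite indep_polyE /rooted_poly (reindex _ (onW_bij _ (@sum_set_bij G K))) /=.
rewrite big_distrlr pair_big_dep /=; apply: eq_big => [[A B]|[A B] _] /=; last first.
  by rewrite card_sum_set exprD.
rewrite independent_sum_set !inE /=.
by case: (_ \in A); rewrite ?andbF ?andbT.
Qed.

(** The linking edge now excludes the root of [K]. *)
Lemma rooted_poly_link_true G K :
  rooted_poly (link G K) true = rooted_poly G true * rooted_poly K false.
Proof.
rewrite /rooted_poly (reindex _ (onW_bij _ (@sum_set_bij G K))) /=.
rewrite big_distrlr pair_big_dep /=; apply: eq_big => [[A B]|[A B] _] /=; last first.
  by rewrite card_sum_set exprD.
rewrite independent_sum_set !inE /=.
by case: (_ \in A); case: (_ \in B); rewrite ?andbF ?andbT.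
Qed.

Lemma independent_bundle H k (P : bool * {ffun 'I_k -> {set H}}) :
  independent (bundle P : {set Zgraph H k}) =
  [forall i, independent (P.2 i) && (P.1 ==> (root_of H \notin P.2 i))].
Proof.
apply/independentP/forallP => [h i|h].
  apply/andP; split.
    apply/independentP => x y Px Py.
    by have := h (Some (i, x)) (Some (i, y)); rewrite !inE /= eqxx => /(_ Px Py).
  apply/implyP => P1; apply/negP => Pr.
  by have := h None (Some (i, root_of H)); rewrite !inE /= eqxx => /(_ P1 Pr).
have root i u : P.1 -> u \in P.2 i -> u != root_of H.
  move=> P1 Pu; have /andP[_] := h i; rewrite P1 /=.
  by apply: contra => /eqP <-.
move=> [[i u]|] [[j w]|]; rewrite !inE //= => Pu Pw.
- apply/negP => /andP[/eqP ij]; apply/negP; subst j.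
  by have /andP[/independentP hi _] := h i; apply: hi.
- exact: root Pw Pu.
- exact: root Pu Pw.
Qed.

Lemma rooted_poly_Zgraph H k b :
  rooted_poly (Zgraph H k) b =
  'X^b * (\sum_(A : {set H} | independent A && (b ==> (root_of H \notin A)))
            'X^#|A|) ^+ k.
Proof.
rewrite /rooted_poly (reindex _ (onW_bij _ (@bundle_bij H k))) /=.
(* The power is a product over ['I_k]; distributivity expands it into a sum over choices of one set
   per copy. *)
rewrite -(card_ord k) -prodr_const card_ord bigA_distr_big /= mulr_sumr.
(* Membership of $v_0$ is fixed by [b], so only the traces on the copies vary. *)
rewrite (reindex_onto (fun f => (b, f)) snd) /=; last first.
  by move=> [c f]; rewrite inE /= => /andP[_ /eqP ->].
apply: eq_big => [f|f _]; last by rewrite card_bundle exprD expr_sum.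
rewrite independent_bundle !inE /= !eqxx !andbT.
by apply/forallP/ffun_onP => h i; have := h i.
Qed.

Lemma rooted_poly_Zgraph_false H k :
  rooted_poly (Zgraph H k) false = indep_poly H R ^+ k.
Proof.
rewrite rooted_poly_Zgraph mul1r indep_polyE.
by under eq_bigl do rewrite andbT.
Qed.

Lemma rooted_poly_Zgraph_true H k :
  rooted_poly (Zgraph H k) true = 'X * rooted_poly H false ^+ k.
Proof.
rewrite rooted_poly_Zgraph /rooted_poly.
by under [in RHS]eq_bigl do rewrite eqbF_neg.
Qed.

Lemma attach_repS G H k m :
  attach_rep G H k m.+1 = attach (attach_rep G H k m) H k.
Proof. by rewrite /attach_rep /attach_seq -addn1 nseqD foldl_cat. Qed.

Lemma rooted_poly_attach_rep_false G H k m :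
  rooted_poly (attach_rep G H k m) false =
  rooted_poly G false * indep_poly (Zgraph H k) R ^+ m.
Proof.
elim: m => [|m IH]; first by rewrite mulr1.
by rewrite attach_repS rooted_poly_link_false IH -mulrA -exprSr.
Qed.

Lemma rooted_poly_attach_rep_true G H k m :
  rooted_poly (attach_rep G H k m) true =
  rooted_poly G true * indep_poly H R ^+ (k * m).
Proof.
elim: m => [|m IH]; first by rewrite muln0 mulr1.
rewrite attach_repS rooted_poly_link_true IH rooted_poly_Zgraph_false.
by rewrite -mulrA -exprD mulnS addnC.
Qed.

Lemma indep_poly_Zgraph H k :
  indep_poly (Zgraph H k) R =
  indep_poly H R ^+ k + 'X * rooted_poly H false ^+ k.
Proof.
by rewrite indep_poly_rooted rooted_poly_Zgraph_false rooted_poly_Zgraph_true.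
Qed.

End RootedPoly.

(** * Closed forms for paths, spiders, $T_{m,t}$ and $U_m$ *)

Section ClosedForms.
Variable R : realType.

Lemma adj_Pgraph1 (x y : Pgraph 1) : adj x y = false.
Proof. by rewrite [x]ord1 [y]ord1. Qed.

Lemma rooted_poly_P1 b : rooted_poly R (Pgraph 1) b = 'X^b.
Proof.
have bij1 : bijective (fun c : bool => [set x : 'I_1 | c]).
  exists (fun A : {set 'I_1} => ord0 \in A) => [c|A]; first by rewrite inE.
  by apply/setP => x; rewrite inE [x]ord1.
rewrite /rooted_poly (reindex _ (onW_bij _ bij1)) (big_pred1 b) => [|c] /=.
  by congr 'X^_; case: b; rewrite cardsE ?cardT ?size_enum_ord ?card0.
rewrite inE; case: independentP => // -[] x y _ _.
by rewrite adj_Pgraph1.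
Qed.

Lemma rooted_poly_P2 b : rooted_poly R (Pgraph 2) b = if b then 'X else 1 + 'X.
Proof.
(* The four vertex sets, coded by membership of the two vertices, root first. *)
pose h (c : bool * bool) := [set x : 'I_2 | if x == ord0 then c.1 else c.2].
have bij2 : bijective h.
  exists (fun A : {set 'I_2} => (ord0 \in A, lift ord0 ord0 \in A)) => [[c d]|A].
    by rewrite !inE.
  apply/setP => x; rewrite inE; case: (unliftP ord0 x) => [y ->|->] //=.
  by rewrite [y]ord1.
have hcard c : #|h c| = (c.1 + c.2)%N.
  by rewrite -sum1dep_card big_mkcond !big_ord_recl big_ord0 /=; case: c => [[] []].
have hindep c : independent (h c : {set Pgraph 2}) = ~~ (c.1 && c.2).
  apply/independentP/idP => [hc|].
    apply/negP => /andP[c1 c2].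
    by have := hc ord0 (lift ord0 ord0); rewrite !inE /= => /(_ c1 c2).
  by case: c => [[] []] //= _ [[|[|//]] ix] [[|[|//]] iy]; rewrite !inE.
rewrite /rooted_poly (reindex _ (onW_bij _ bij2)) /=.
under eq_bigl do rewrite hindep inE /=.
under eq_bigr do rewrite hcard.
rewrite big_mkcond -(pair_bigA _ (fun c d : bool =>
  if ~~ (c && d) && (c == b) then 'X^(c + d) else 0)) /=.
by rewrite !big_bool; case: b => /=; rewrite ?addr0 ?add0r // addrC.
Qed.

Lemma indep_poly_P1 : indep_poly (Pgraph 1) R = 1 + 'X.
Proof. by rewrite indep_poly_rooted !rooted_poly_P1. Qed.

Lemma indep_poly_P2 : indep_poly (Pgraph 2) R = 1 + 'X *+ 2.
Proof. by rewrite indep_poly_rooted !rooted_poly_P2 -addrA. Qed.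

(** Deleting the center leaves $t$ disjoint edges. *)
Lemma rooted_poly_S2_false t :
  rooted_poly R (S2graph t) false = (1 + 'X *+ 2) ^+ t.
Proof.
rewrite rooted_poly_attach_rep_false indep_poly_Zgraph indep_poly_P1.
by rewrite !rooted_poly_P1 mul1r !expr1 mulr1 -addrA.
Qed.

(** Choosing the center excludes its neighbors and leaves $t$ isolated leaves, whence the second
    term. *)
Lemma indep_poly_S2 t :
  indep_poly (S2graph t) R = (1 + 'X *+ 2) ^+ t + 'X * (1 + 'X) ^+ t.
Proof.
rewrite indep_poly_rooted rooted_poly_S2_false; congr (_ + _).
by rewrite rooted_poly_attach_rep_true indep_poly_P1 rooted_poly_P1 mul1n.
Qed.

(** $Z_t(P_2)$ is the spider $S_{2,t}$, so deleting the root leaves $m$ spiders. *)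
Lemma rooted_poly_T_false m t :
  rooted_poly R (Tgraph m t) false = indep_poly (S2graph t) R ^+ m.
Proof.
rewrite rooted_poly_attach_rep_false indep_poly_Zgraph indep_poly_P2.
by rewrite rooted_poly_P1 rooted_poly_P2 mul1r indep_poly_S2.
Qed.

Lemma rooted_poly_T_true m t :
  rooted_poly R (Tgraph m t) true = 'X * indep_poly (Pgraph 2) R ^+ (t * m).
Proof. by rewrite rooted_poly_attach_rep_true rooted_poly_P1. Qed.

Lemma indep_poly_T m t :
  indep_poly (Tgraph m t) R =
  indep_poly (S2graph t) R ^+ m + 'X * indep_poly (Pgraph 2) R ^+ (t * m).
Proof. by rewrite indep_poly_rooted rooted_poly_T_false rooted_poly_T_true. Qed.

(** Both graphs are a vertex joined to the centers of $k$ spiders; comparing polynomials avoids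
    building an isomorphism. *)
Lemma indep_poly_Zgraph_S2 n k :
  indep_poly (Zgraph (S2graph n) k) R = indep_poly (Tgraph k n) R.
Proof.
by rewrite indep_poly_Zgraph rooted_poly_S2_false indep_poly_T indep_poly_P2 exprM.
Qed.

Lemma indep_poly_U k l n m :
  indep_poly (Ugraph k l n m) R =
  indep_poly (S2graph l) R * indep_poly (Tgraph k n) R ^+ m +
  'X * indep_poly (Pgraph 2) R ^+ l * indep_poly (S2graph n) R ^+ (k * m).
Proof.
rewrite indep_poly_rooted rooted_poly_attach_rep_false.
rewrite rooted_poly_attach_rep_true rooted_poly_T_false rooted_poly_T_true.
by rewrite indep_poly_Zgraph_S2 expr1 muln1.
Qed.

(** * Degrees and independence numbers *)

(* Positive leading coefficients do not cancel, so degrees of sums are maxima. *)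
Definition pos_deg d (p : {poly R}) := (size p == d.+1) && (0 < lead_coef p).

Lemma pos_degM d e p q :
  pos_deg d p -> pos_deg e q -> pos_deg (d + e)%N (p * q).
Proof.
move=> /andP[/eqP sp lp] /andP[/eqP sq lq]; rewrite /pos_deg lead_coefM mulr_gt0 //.
by rewrite size_mul -?size_poly_eq0 ?sp ?sq // addnS eqxx.
Qed.

Lemma pos_deg1 : pos_deg 0 1.
Proof. by rewrite /pos_deg size_poly1 lead_coef1 ltr01. Qed.

Lemma pos_degX : pos_deg 1 'X.
Proof. by rewrite /pos_deg size_polyX lead_coefX ltr01. Qed.

Lemma pos_deg_exp d p m : pos_deg d p -> pos_deg (d * m)%N (p ^+ m).
Proof.
move=> dp; elim: m => [|m IH]; first by rewrite muln0; exact: pos_deg1.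
by rewrite mulnS exprS; exact: pos_degM.
Qed.

Lemma pos_deg_Xexp p t : pos_deg 1 p -> pos_deg t.+1 ('X * p ^+ t).
Proof.
move=> /(pos_deg_exp t); rewrite mul1n => dp.
by rewrite -add1n; exact: pos_degM pos_degX dp.
Qed.

Lemma pos_degDl d e p q :
  pos_deg d p -> pos_deg e q -> (e <= d)%N -> pos_deg d (p + q).
Proof.
move=> /andP[/eqP sp lp] /andP[/eqP sq lq].
rewrite leq_eqVlt => /predU1P[ed|ltde]; last first.
  have ltqp : (size q < size p)%N by rewrite sp sq.
  by rewrite /pos_deg size_polyDl ?lead_coefDl // sp eqxx.
(* Equal degrees: the coefficient at [d] is a sum of two positive leading coefficients, which bounds
   the size from below. *)
have cpos : 0 < (p + q)`_d.
  by move: lp lq; rewrite !lead_coefE sp sq /= ed coefD; exact: addr_gt0.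
have spq : size (p + q) = d.+1.
  apply/eqP; rewrite eqn_leq (leq_trans (size_polyD _ _)) /=; last first.
    by rewrite sp sq ed maxnn.
  by rewrite ltnNge; apply: contraTN cpos => /leq_sizeP -> //; rewrite ltxx.
by rewrite /pos_deg lead_coefE spq eqxx.
Qed.

Lemma pos_degDr d e p q :
  pos_deg d p -> pos_deg e q -> (d <= e)%N -> pos_deg e (p + q).
Proof. by move=> dp eq le; rewrite addrC; exact: pos_degDl eq dp le. Qed.

Lemma pos_deg_alpha d (G : sgraph) : pos_deg d (indep_poly G R) -> alpha G = d.
Proof. by rewrite /pos_deg size_indep_poly => /andP[/eqP[]]. Qed.

Lemma pos_deg_P2 : pos_deg 1 (indep_poly (Pgraph 2) R).
Proof.
rewrite indep_poly_P2; apply: pos_degDr pos_deg1 _ _ => //.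
exact: pos_degDl pos_degX pos_degX _.
Qed.

(** The term $x(1+x)^t$ dominates $(1+2x)^t$ by one degree. *)
Lemma pos_deg_S2 t : pos_deg t.+1 (indep_poly (S2graph t) R).
Proof.
rewrite indep_poly_S2 -indep_poly_P2.
apply: pos_degDr (pos_deg_exp t pos_deg_P2) _ _; last by rewrite mul1n.
apply: pos_deg_Xexp.
exact: pos_degDr pos_deg1 pos_degX _.
Qed.

(* For [m = 0] the degree is 1: this is where [0 < k] enters the theorem. *)
Lemma pos_deg_T m t : (0 < m)%N -> pos_deg (m * t.+1) (indep_poly (Tgraph m t) R).
Proof.
move=> m_gt0; rewrite indep_poly_T [(m * _)%N]mulnC.
apply: pos_degDl (pos_deg_exp _ (pos_deg_S2 _)) (pos_deg_Xexp _ pos_deg_P2) _.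
by rewrite mulSn -add1n leq_add2r.
Qed.

Lemma pos_deg_U k l n m : (0 < k)%N ->
  pos_deg (l.+1 + k * n.+1 * m) (indep_poly (Ugraph k l n m) R).
Proof.
move=> k_gt0; rewrite indep_poly_U.
apply: pos_degDl (leqnn _).
  exact: pos_degM (pos_deg_S2 _) (pos_deg_exp _ (pos_deg_T _ k_gt0)).
(* The second summand's degree arises as $(l+1)+(n+1)(km)$. *)
rewrite [(k * _)%N]mulnC -mulnA.
exact: pos_degM (pos_deg_Xexp _ pos_deg_P2) (pos_deg_exp _ (pos_deg_S2 _)).
Qed.

(** * Reciprocal polynomials *)

Lemma horner_RI d (G : sgraph) (x : R) : x != 0 ->
  pos_deg d (indep_poly G R) -> (RI R G).[x] = x ^+ d * (indep_poly G R).[x^-1].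
Proof. by move=> x0 /andP[/eqP sG _]; rewrite horner_recip // sG. Qed.

(** Lets reciprocals be compared by evaluation, where $p(1/x)$ makes sense. *)
Lemma poly_eq_nonzero (p q : {poly R}) :
  (forall x, x != 0 -> p.[x] = q.[x]) -> p = q.
Proof.
move=> pq; apply: subr0_eq.
(* The points $1,2,\ldots$ are distinct and nonzero in characteristic 0; taking [size (p - q)] of
   them exceeds the possible number of roots of a nonzero difference. *)
pose rs : seq R := [seq i.+1%:R | i <- iota 0 (size (p - q))].
apply: (roots_geq_poly_eq0 (rs := rs)).
- apply/allP => _ /mapP[i _ ->]; rewrite rootE !hornerE pq ?subrr //.
  by rewrite pnatr_eq0.
- by rewrite map_inj_uniq ?iota_uniq // => i j /eqP; rewrite eqr_nat => /eqP[].
- by rewrite size_map size_iota.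
Qed.

Lemma RI_U k l n m : (0 < k)%N ->
  RI R (Ugraph k l n m) =
    RI R (S2graph l) * RI R (Tgraph k n) ^+ m
    + RI R (Pgraph 2) ^+ l * RI R (S2graph n) ^+ (k * m).
Proof.
move=> k_gt0; apply: poly_eq_nonzero => x x0; rewrite !hornerE.
rewrite (horner_RI x0 (pos_deg_U l n m k_gt0)) (horner_RI x0 (pos_deg_S2 l)).
rewrite (horner_RI x0 (pos_deg_T n k_gt0)) (horner_RI x0 pos_deg_P2).
rewrite (horner_RI x0 (pos_deg_S2 n)) indep_poly_U !hornerE mulrDr.
rewrite !exprMn -!exprM [(n.+1 * _)%N]mulnCA !mulnA !exprD; congr (_ + _).
  by rewrite mulrACA.
(* The $x^{-1}$ from the factor ['X] cancels one power in [x ^+ l.+1], leaving $x^l$ to reverse the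
   $l$ factors $I(P_2)$. *)
by rewrite exprS; field.
Qed.

End ClosedForms.

(** * The linear recurrence and the conclusion *)

(** Each of $u^m$ and $v^m$ satisfies the recurrence, as [u] and [v] are the roots of
    $r^2-(u+v)r+uv$, and the recurrence is linear. *)
Lemma linearly_recurrent2_sum_exp (A : comNzRingType) (a b u v : A) :
  linearly_recurrent2 (fun m => a * u ^+ m + b * v ^+ m)
    (('X - v%:P) * ('X - u%:P)).
Proof.
exists (u + v), (- (u * v)); split.
  by rewrite -mul_polyC polyCD polyCN polyCM; ring.
move=> [|[|m]] // _; rewrite !subSS !subn0 !exprS; ring.
Qed.

Theorem theorem4p11 (R : realType) (k l n : nat) (k_gt0 : (0 < k)%N) :
  [/\ forall m : nat, alpha (Ugraph k l n m) = (k * (n + 1) * m + l + 1)%N,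
      forall m : nat,
        RI R (Ugraph k l n m) =
          RI R (S2graph l) * RI R (Tgraph k n) ^+ m
          + RI R (Pgraph 2) ^+ l * RI R (S2graph n) ^+ (k * m)
    & linearly_recurrent2 (fun m : nat => RI R (Ugraph k l n m))
        (('X - (RI R (S2graph n) ^+ k)%:P) * ('X - (RI R (Tgraph k n))%:P))].
Proof.
split=> [m|m|].
- by rewrite (pos_deg_alpha (pos_deg_U R l n m k_gt0)) addn1 addnC addn1 addnS.
- exact: RI_U.
have [c1 [c0 [-> rec]]] := linearly_recurrent2_sum_exp (RI R (S2graph l))
  (RI R (Pgraph 2) ^+ l) (RI R (Tgraph k n)) (RI R (S2graph n) ^+ k).
exists c1, c0; split=> // m m_ge2.
(* Reading the power $km$ as an $m$-th power of a $k$-th power makes the second summand geometric in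
   $m$. *)
by rewrite !RI_U // !exprM; exact: rec.
Qed.
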